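(* Let $G$ be a directed graph and $v$ a vertex of $G$; let $E(v)$ be the set of edges incident at $v$ and $A(v)=\mathbb{Z}[E(v)]/\mathrm{ann}_{\mathbb{Z}[E(v)]}\mathscr H_0(G)$, a graded $\mathbb{Z}[E(v)]$-module. 1. There are no undirected cycles in $G$ containing $v$ if and only if $A(v)\cong\mathbb{Z}$ as graded $\mathbb{Z}[E(v)]$-modules, where $\mathbb{Z}$ denotes $\mathbb{Z}[E(v)]/(E(v))$ and $(E(v))$ is the ideal generated by $E(v)$. 2. There is an undirected cycle in $G$ containing $v$ if and only if $A_1(v)\ne0$, where $A_1(v)$ is the homogeneous component of $A(v)$ of degree $1$. 3. $\alpha_{undirected}(G,v)\le\operatorname{rank}_{\mathbb{Z}}A_1(v)\le\beta_{undirected}(G,v)$.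
   Context: A directed graph $G$: finite sets $V(G)$, $E(G)$, each edge with an initial and a terminal vertex; loops and multiple edges allowed; no vertex of degree $0$. An undirected cycle is a sequence $v_0,x_0,v_1,\dots,v_n,x_n,v_0$ with $v_0,\dots,v_n$ pairwise distinct and each $x_i$ an edge joining $v_i$ and $v_{i+1}$ in either direction. $\alpha_{undirected}(G,v)$ is the maximal number of pairwise edge-disjoint undirected cycles each containing $v$; $\beta_{undirected}(G,v)$ is the minimal number of edges incident at $v$ whose removal destroys all undirected cycles containing $v$. $\mathbb{Z}[E(G)]$ is graded with edges of degree $1$. For a vertex $w$ with outgoing edges $x_1,\dots,x_m$ and incoming edges $y_1,\dots,y_n$ (loops in both lists), $k_w=\max\{m,n\}$, $\delta_{w,l}=e_l(x_1,\dots,x_m)-e_l(y_1,\dots,y_n)$, $1\le l\le k_w$ ($e_l$ elementary symmetric); $\Delta_G$ lists all these. For homogeneous $r$ in a graded commutative ring $R$, $C^R(r)$ is $0\to R\{\deg r\}\xrightarrow{r}R\to0$ (homological degrees $1,0$) and $C^R(r_1,\dots,r_k)=\bigotimes_R C^R(r_i)$. $\mathscr H_0(G)$ is the $0$-th homology of $C^{\mathbb{Z}[E(G)]}_*(\Delta_G)$, a graded $\mathbb{Z}[E(G)]$-module; $\mathrm{ann}$ denotes the annihilator in the subring $\mathbb{Z}[E(v)]$.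
   Formalization: The edges x_0,…,x_n of an undirected cycle are also required to be pairwise distinct; otherwise v_0,x,v_1,x,v_0 would make every non-loop edge a cycle, and all three items would fail for a graph with a single edge joining two vertices. *)

(* Defs.v *)
From HB Require Import structures.
From mathcomp Require Import all_boot all_order all_algebra.
From mathcomp Require Import boolp.
From mathcomp Require Import mpoly.
From mathcomp Require Import ring_quotient.

Set Implicit Arguments.
Unset Strict Implicit.
Unset Printing Implicit Defensive.

Import GRing.Theory.
Local Open Scope ring_scope.
Local Open Scope quotient_scope.
#[local] Obligation Tactic := idtac.

Section QuotientModule.
Variables (R : nzRingType) (M : lmodType R).

Record submodule := Submodule {
  submod_mem :> M -> Prop;
  submod0 : submod_mem 0;
  submodP : forall a u w,
    submod_mem u -> submod_mem w -> submod_mem (a *: u + w) }.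

Variable N : submodule.

Definition submod_pred : pred M := fun u => `[< N u >].

Lemma submod_pred_closed : submod_closed submod_pred.
Proof.
split=> [|a u w]; first by apply/asboolP; exact: submod0.
by move=> /asboolP Nu /asboolP Nw; apply/asboolP; exact: submodP.
Qed.

HB.instance Definition _ :=
  GRing.isZmodClosed.Build M submod_pred (GRing.submod_closedB submod_pred_closed).

Local Notation zmod_quot :=
  (Quotient.quot (GRing.ZmodClosed.clone M submod_pred _)).

Definition quotmod : Type := zmod_quot.
HB.instance Definition _ := GRing.Zmodule.on quotmod.

Definition quotmod_pi (u : M) : quotmod := \pi_(zmod_quot) u.

Lemma quotmod_piB : {morph quotmod_pi : u w / u - w}.
Proof. by move=> u w; exact: pi_is_zmod_morphism. Qed.
HB.instance Definition _ :=
  GRing.isZmodMorphism.Build M quotmod quotmod_pi quotmod_piB.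

Lemma quotmod_piE u w : (quotmod_pi u = quotmod_pi w) <-> N (u - w).
Proof.
rewrite /quotmod_pi; split.
  by move/eqP; rewrite -Quotient.idealrBE => /asboolP.
by move=> Nuw; apply/eqP; rewrite -Quotient.idealrBE; apply/asboolP.
Qed.

Lemma quotmod_surj (x : quotmod) : exists u, quotmod_pi u = x.
Proof. by exists (repr x); rewrite /quotmod_pi reprK. Qed.

Definition quotmod_scale (a : R) (x : quotmod) : quotmod :=
  quotmod_pi (a *: repr (x : zmod_quot)).

Lemma quotmod_scale_pi a u :
  quotmod_scale a (quotmod_pi u) = quotmod_pi (a *: u).
Proof.
apply/quotmod_piE; rewrite -scalerBr -[X in N X]addr0.
apply: submodP (submod0 N); apply/quotmod_piE.
by rewrite /quotmod_pi reprK.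
Qed.

Lemma quotmod_scaleA a b x :
  quotmod_scale a (quotmod_scale b x) = quotmod_scale (a * b) x.
Proof. by have [u <-] := quotmod_surj x; rewrite !quotmod_scale_pi scalerA. Qed.

Lemma quotmod_scale1 : left_id 1 quotmod_scale.
Proof. by move=> x; have [u <-] := quotmod_surj x; rewrite quotmod_scale_pi scale1r. Qed.

Lemma quotmod_scaleDr : right_distributive quotmod_scale +%R.
Proof.
move=> a x y; have [u <-] := quotmod_surj x; have [w <-] := quotmod_surj y.
by rewrite -raddfD !quotmod_scale_pi scalerDr raddfD.
Qed.

Lemma quotmod_scaleDl x : {morph quotmod_scale^~ x : a b / a + b}.
Proof.
by move=> a b; have [u <-] := quotmod_surj x; rewrite !quotmod_scale_pi scalerDl raddfD.
Qed.

HB.instance Definition _ := GRing.Zmodule_isLmodule.Build R quotmod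
  quotmod_scaleA quotmod_scale1 quotmod_scaleDr quotmod_scaleDl.

Lemma quotmod_pi_scalable : scalable quotmod_pi.
Proof. by move=> a u; rewrite -quotmod_scale_pi. Qed.
HB.instance Definition _ :=
  GRing.isScalable.Build R M quotmod *:%R quotmod_pi quotmod_pi_scalable.

End QuotientModule.

Section Ideals.
Variable R : comNzRingType.

Program Definition ideal_gen (I : finType) (g : I -> R) : submodule R^o :=
  @Submodule R R^o (fun p => exists c : I -> R, p = \sum_i c i * g i) _ _.
Next Obligation.
by move=> I g; exists (fun=> 0); rewrite big1 // => i _; rewrite mul0r.
Qed.
Next Obligation.
move=> I g a _ _ [c ->] [c' ->]; exists (fun i => a * c i + c' i).
rewrite /GRing.scale /= mulr_sumr -big_split /=.
by apply: eq_bigr => i _; rewrite mulrDl mulrA.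
Qed.

(* The module M over T is regarded as an R-module through f. *)
Program Definition annihilator (T : nzRingType) (f : {rmorphism R -> T})
    (M : lmodType T) : submodule R^o :=
  @Submodule R R^o (fun p => forall h : M, f p *: h = 0) _ _.
Next Obligation. by move=> T f M h; rewrite rmorph0 scale0r. Qed.
Next Obligation.
move=> T f M a p q Hp Hq h.
by rewrite rmorphD rmorphM scalerDl -scalerA Hp Hq scaler0 addr0.
Qed.

End Ideals.

Section ChainComplexes.
Variable R : comNzRingType.

(* Bounded complexes of finitely generated free R-modules with a chosen
   homogeneous basis [gen]; [bd b c] is the coefficient of [c] in the boundary
   of [b].  Only the homological degree is recorded: the internal shifts
   R{deg r} change neither the homology modules nor their annihilators. *)
Record complex := Complex {
  gen : finType;
  hdeg : gen -> nat;
  bd : gen -> gen -> R;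
  bd_deg : forall b c, bd b c != 0 -> hdeg b = (hdeg c).+1;
  bd_bd : forall b e, \sum_c bd b c * bd c e = 0 }.

Definition chain (C : complex) := {ffun gen C -> R^o}.
HB.instance Definition _ C := GRing.Lmodule.on (chain C).

Section Homology.
Variables (C : complex) (p : nat).

Definition boundary (z : chain C) : chain C := [ffun c => \sum_b z b * bd b c].

Lemma boundary_linear a z w :
  boundary (a *: z + w) = a *: boundary z + boundary w.
Proof.
apply/ffunP => c; rewrite !ffunE /GRing.scale /= mulr_sumr -big_split /=.
by apply: eq_bigr => b _; rewrite !ffunE mulrDl mulrA.
Qed.

Definition in_degree (k : nat) (z : chain C) : bool :=
  [forall b, (z b != 0) ==> (hdeg b == k)].

Lemma in_degree_closed k : submod_closed (in_degree k).
Proof.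
split=> [|a z w /forallP zk /forallP wk].
  by apply/forallP => b; rewrite ffunE eqxx.
apply/forallP => b; apply/implyP; rewrite !ffunE.
have [//|bk] := eqVneq (hdeg b) k.
have /negPn/eqP-> : ~~ (z b != 0) by apply: contra bk => zb; move: (zk b); rewrite zb.
have /negPn/eqP-> : ~~ (w b != 0) by apply: contra bk => wb; move: (wk b); rewrite wb.
by rewrite scaler0 addr0 eqxx.
Qed.

Definition is_cycle (z : chain C) : bool := in_degree p z && (boundary z == 0).

Lemma boundary0 : boundary 0 = 0.
Proof. by apply/ffunP => c; rewrite !ffunE big1 // => b _; rewrite ffunE mul0r. Qed.

Lemma is_cycle_closed : submod_closed is_cycle.
Proof.
have [d0 dD] := in_degree_closed p.
split=> [|a z w /andP[zp /eqP z0] /andP[wp /eqP w0]].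
  by apply/andP; split; [exact: d0 | rewrite boundary0].
apply/andP; split; first exact: dD.
by rewrite boundary_linear z0 w0 scaler0 addr0.
Qed.

HB.instance Definition _ :=
  GRing.isSubmodClosed.Build R (chain C) is_cycle is_cycle_closed.

Record cycles := Cycle { cycle_val :> chain C; _ : is_cycle cycle_val }.
HB.instance Definition _ := [isSub for cycle_val].
HB.instance Definition _ := [Choice of cycles by <:].
HB.instance Definition _ := [SubChoice_isSubLmodule of cycles by <:].

Program Definition boundaries : submodule cycles :=
  @Submodule R cycles
    (fun z => exists2 y, in_degree p.+1 y & boundary y = cycle_val z) _ _.
Next Obligation.
by have [d0 _] := in_degree_closed p.+1; exists 0; [exact: d0 | rewrite boundary0].
Qed.
Next Obligation.
move=> a z w [y yp yz] [x xp xw]; exists (a *: y + x).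
  by have [_ dD] := in_degree_closed p.+1; exact: dD.
by rewrite boundary_linear yz xw.
Qed.

Definition homology : lmodType R := quotmod boundaries.

End Homology.

Lemma unit_bd_deg (b c : unit) : (0 : R) != 0 -> 0%N = 1%N.
Proof. by rewrite eqxx. Qed.

Lemma unit_bd_bd (b e : unit) : \sum_(c : unit) (0 : R) * 0 = 0.
Proof. by rewrite big1 // => c _; rewrite mul0r. Qed.

Definition unit_complex : complex := Complex unit_bd_deg unit_bd_bd.

(* 0 -> R -r-> R -> 0, with generators [true] in degree 1, [false] in degree 0 *)
Definition mult_bd (r : R) (b c : bool) : R := if b && ~~ c then r else 0.

Lemma mult_bd_deg r b c : mult_bd r b c != 0 -> nat_of_bool b = (nat_of_bool c).+1.
Proof. by case: b c => [] []; rewrite /mult_bd ?eqxx. Qed.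

Lemma mult_bd_bd r b e : \sum_c mult_bd r b c * mult_bd r c e = 0.
Proof. by rewrite big_bool /mult_bd /= andbF !(mul0r, mulr0) addr0. Qed.

Definition mult_complex (r : R) : complex :=
  Complex (@mult_bd_deg r) (@mult_bd_bd r).

Section Tensor.
Variables C D : complex.

Definition tensor_bd (b c : gen C * gen D) : R :=
  bd b.1 c.1 *+ (b.2 == c.2)
  + (-1) ^+ hdeg b.1 * bd b.2 c.2 *+ (b.1 == c.1).

Lemma tensor_bd_deg b c : tensor_bd b c != 0 ->
  (hdeg b.1 + hdeg b.2 = (hdeg c.1 + hdeg c.2).+1)%N.
Proof.
case: b c => [a x] [b y]; rewrite /tensor_bd /=.
have [ab0|/bd_deg ab] := eqVneq (bd a b) 0.
  rewrite ab0 mul0rn add0r; have [->|_] := eqVneq a b; last by rewrite mulr0n eqxx.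
  have [->|/bd_deg -> _] := eqVneq (bd x y) 0; first by rewrite mulr0 mul0rn eqxx.
  by rewrite addnS.
have /negPf-> : a != b by apply: contra_eq_neq ab => ->; rewrite ltn_eqF.
rewrite mulr0n addr0 ab; have [->//|_] := eqVneq x y.
by rewrite mulr0n eqxx.
Qed.

Lemma tensor_bd_bd b e : \sum_c tensor_bd b c * tensor_bd c e = 0.
Proof.
case: b e => [a x] [c z].
rewrite -(pair_bigA _ (fun b y => tensor_bd (a, x) (b, y) * tensor_bd (b, y) (c, z))) /=.
rewrite /tensor_bd /=.
under eq_bigr => b _ do under eq_bigr => y _ do rewrite mulrDl !mulrDr.
under eq_bigr => b _ do rewrite !big_split /=.
rewrite !big_split /=.
have -> : \sum_b \sum_y (bd a b *+ (x == y)) * (bd b c *+ (y == z)) = 0 :> R.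
  rewrite exchange_big (bigD1 x) //= [X in _ + X]big1 ?addr0; last first.
    by move=> y /negPf yx; rewrite big1 // => b _; rewrite eq_sym yx mulr0n mul0r.
  under eq_bigr => b _ do rewrite eqxx mulr1n.
  by case: eqP => _; [rewrite bd_bd | rewrite big1 // => b _; rewrite mulr0].
have -> : \sum_b \sum_y ((-1) ^+ hdeg a * bd x y *+ (a == b)) *
            ((-1) ^+ hdeg b * bd y z *+ (b == c)) = 0 :> R.
  rewrite (bigD1 a) //= [X in _ + X]big1 ?addr0; last first.
    by move=> b /negPf ba; rewrite big1 // => y _; rewrite eq_sym ba mulr0n mul0r.
  under eq_bigr => y _ do rewrite eqxx mulr1n -mulrnAr mulrACA -expr2 sqrr_sign mul1r.
  by case: eqP => _; [rewrite bd_bd | rewrite big1 // => y _; rewrite mulr0].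
have -> : \sum_b \sum_y (bd a b *+ (x == y)) *
            ((-1) ^+ hdeg b * bd y z *+ (b == c))
          = (-1) ^+ hdeg c * (bd a c * bd x z) :> R.
  rewrite (bigD1 c) //= [X in _ + X]big1 ?addr0; last first.
    by move=> b /negPf bc; rewrite big1 // => y _; rewrite bc mulr0n mulr0.
  rewrite (bigD1 x) //= [X in _ + X]big1 ?addr0; last first.
    by move=> y /negPf yx; rewrite eq_sym yx mulr0n mul0r.
  by rewrite !eqxx !mulr1n mulrCA.
have -> : \sum_b \sum_y ((-1) ^+ hdeg a * bd x y *+ (a == b)) *
            (bd b c *+ (y == z))
          = (-1) ^+ hdeg a * (bd a c * bd x z) :> R.
  rewrite (bigD1 a) //= [X in _ + X]big1 ?addr0; last first.
    by move=> b /negPf ba; rewrite big1 // => y _; rewrite eq_sym ba mulr0n mul0r.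
  rewrite (bigD1 z) //= [X in _ + X]big1 ?addr0; last first.
    by move=> y /negPf yz; rewrite yz mulr0n mulr0.
  by rewrite !eqxx !mulr1n -mulrA [bd x z * _]mulrC.
rewrite add0r addr0.
have [->|/bd_deg ->] := eqVneq (bd a c) 0; first by rewrite mul0r !mulr0 addr0.
by rewrite exprS mulN1r mulNr ?addNr ?subrr.
Qed.

Definition tensor : complex :=
  @Complex (gen C * gen D)%type (fun b => (hdeg b.1 + hdeg b.2)%N) tensor_bd
    tensor_bd_deg tensor_bd_bd.

End Tensor.

Definition koszul (rs : seq R) : complex :=
  foldr (fun r C => tensor (mult_complex r) C) unit_complex rs.

End ChainComplexes.

Record digraph := Digraph {
  vertex : finType;
  edge : finType;
  source : edge -> vertex;
  target : edge -> vertex;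
  no_isolated : forall w, exists x, (source x == w) || (target x == w) }.

Section Graph.
Variable G : digraph.

Definition out_edges (w : vertex G) : {set edge G} := [set x | source x == w].
Definition in_edges (w : vertex G) : {set edge G} := [set x | target x == w].
Definition inc_edges (w : vertex G) : {set edge G} := out_edges w :|: in_edges w.

Definition joins (x : edge G) (u w : vertex G) : bool :=
  (source x == u) && (target x == w) || (source x == w) && (target x == u).

(* The sequence v_0, x_0, ..., v_n, x_n, v_0 is encoded by the pairs
   (v_0, x_0), ..., (v_n, x_n), the wrap-around condition being part of
   [path.cycle].  Distinctness of the edges only matters when n = 1, where it
   excludes walking back and forth along a single edge. *)
Definition ucycle (s : seq (vertex G * edge G)) : bool :=
  [&& s != [::], uniq (unzip1 s), uniq (unzip2 s) &
      path.cycle (fun a b => joins a.2 a.1 b.1) s].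

Definition ucycle_through (v : vertex G) (s : seq (vertex G * edge G)) : bool :=
  ucycle s && (v \in unzip1 s).

Definition is_ucycle_edge_set (v : vertex G) (C : {set edge G}) : Prop :=
  exists2 s, ucycle_through v s & C = [set x in unzip2 s].

Definition alpha_undirected (v : vertex G) : nat :=
  \max_(P : {set {set edge G}} |
      trivIset P && [forall C in P, `[< is_ucycle_edge_set v C >]]) #|P|.

Definition cuts_ucycles (v : vertex G) (S : {set edge G}) : Prop :=
  forall s, ucycle_through v s -> has (mem S) (unzip2 s).

(* [inc_edges v] itself destroys all cycles through v, so the default value
   of the arg min is always admissible. *)
Definition beta_undirected (v : vertex G) : nat :=
  #|[arg min_(S < inc_edges v |
       (S \subset inc_edges v) && `[< cuts_ucycles v S >]) #|S|]|.

(* Z[F] for a set F of edges; the edge x is the variable of index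
   [enum_rank x], resp. the variable i is the edge [enum_val i]. *)
Definition polyE : comNzRingType := {mpoly int[#|edge G|]}.
Definition polyF (F : {set edge G}) : comNzRingType := {mpoly int[#|F|]}.

Definition edge_var (x : edge G) : polyE := 'X_(enum_rank x).

Definition embed (F : {set edge G}) : {rmorphism polyF F -> polyE} :=
  mmap intr (fun i : 'I_#|F| => edge_var (enum_val i)).

Definition esym (A : {set edge G}) (l : nat) : polyE :=
  \sum_(S : {set edge G} | (S \subset A) && (#|S| == l)) \prod_(x in S) edge_var x.

Definition kmax (w : vertex G) : nat := maxn #|out_edges w| #|in_edges w|.

Definition delta (w : vertex G) (l : nat) : polyE :=
  esym (out_edges w) l - esym (in_edges w) l.

Definition Delta : seq polyE :=
  [seq delta w l | w <- enum (vertex G), l <- iota 1 (kmax w)].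

Definition scrH0 : lmodType polyE := homology (koszul Delta) 0.

Section AtVertex.
Variable v : vertex G.

Definition polyV : comNzRingType := polyF (inc_edges v).

Definition Aloc : lmodType polyV := quotmod (annihilator (embed (inc_edges v)) scrH0).

Definition Ztriv : lmodType polyV :=
  quotmod (ideal_gen (fun i : 'I_#|inc_edges v| => 'X_i : polyV)).

End AtVertex.

End Graph.

(* Homogeneous component of degree d of a quotient of Z[F]; the ideals used
   here are homogeneous, so these components do grade the quotient. *)
Definition qcomponent n (I : submodule ({mpoly int[n]}^o)) (d : nat)
    (a : quotmod I) : Prop :=
  exists2 p : {mpoly int[n]}, p \is d.-homog & a = quotmod_pi I p.

Definition graded_iso (R : nzRingType) (M N : lmodType R)
    (Md : nat -> M -> Prop) (Nd : nat -> N -> Prop) : Prop :=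
  exists f : {linear M -> N},
    bijective f /\ forall d x, Md d x <-> Nd d (f x).

Definition Zfree (M : zmodType) (n : nat) (x : 'I_n -> M) : Prop :=
  forall c : 'I_n -> int, \sum_i x i *~ c i = 0 -> forall i, c i = 0.

Definition has_rank (M : zmodType) (P : M -> Prop) (r : nat) : Prop :=
  (exists x : 'I_r -> M, (forall i, P (x i)) /\ Zfree x) /\
  (forall n (x : 'I_n -> M), (forall i, P (x i)) -> Zfree x -> (n <= r)%N).

Definition Acomp (G : digraph) (v : vertex G) : nat -> Aloc v -> Prop :=
  @qcomponent _ (annihilator (embed (inc_edges v)) (scrH0 G)).
Definition Zcomp (G : digraph) (v : vertex G) : nat -> Ztriv v -> Prop :=
  @qcomponent _ (ideal_gen (fun i : 'I_#|inc_edges v| => 'X_i : polyV v)).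

(* Main.v *)
(** H_0 of the Koszul complex is Z[E(G)]/(Delta), and modulo products of edges
    only the delta_{w,1} matter: a linear form sum c_x x on E(v) annihilates H_0
    iff c, extended by 0 outside E(v), is the coboundary of a potential on V(G).
    Let S be a minimum set of edges at v meeting all undirected cycles through v.
    - S spans A_1(v): an edge y at v outside S leads to a component K of G - v
      which no other edge of E(v) \ S touches, so the coboundary of the indicator
      of K expresses y through S.
    - S is free in A_1(v): by minimality each x in S lies on a cycle through v
      with no other edge in S, and a coboundary sums to 0 around that cycle.
    Hence rank A_1(v) = beta(G, v) exactly; and alpha <= beta since disjoint cycles
    through v meet S in distinct edges. *)
From HB Require Import structures.
Require Import Defs.
From mathcomp Require Import all_boot all_order all_algebra.
From mathcomp Require Import boolp mpoly.

Set Implicit Arguments.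
Unset Strict Implicit.
Unset Printing Implicit Defensive.

Import GRing.Theory.
Local Open Scope ring_scope.

(** * Submodules and their quotients *)

Section Submodule.
Variables (R : nzRingType) (M : lmodType R).
Implicit Type N : submodule M.

Lemma submodD N u w : N u -> N w -> N (u + w).
Proof. by move=> Nu Nw; rewrite -[u]scale1r; apply: submodP. Qed.

Lemma submodZ N a u : N u -> N (a *: u).
Proof. by move=> Nu; rewrite -[_ *: _]addr0; apply: submodP => //; apply: submod0. Qed.

Lemma submod_sum N (I : Type) (r : seq I) (P : pred I) (F : I -> M) :
  (forall i, P i -> N (F i)) -> N (\sum_(i <- r | P i) F i).
Proof. by move=> NF; apply: (big_ind N) => //; [apply: submod0|apply: submodD]. Qed.

Lemma submod_eq N N' : (forall u, N u <-> N' u) -> N = N'.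
Proof.
case: N N' => [N N0 NP] [N' N'0 N'P] /= eqN.
have eN : N = N' by apply/funext => u; apply/propext.
by case: N' / eN N'0 N'P {eqN} => *; congr Submodule; apply: Prop_irrelevance.
Qed.

Lemma quotmod_pi_eq0 N u : quotmod_pi N u = 0 <-> N u.
Proof. by rewrite -[0](raddf0 (quotmod_pi N)) quotmod_piE subr0. Qed.

End Submodule.

(** * The annihilator of the 0-th Koszul homology *)

Section KoszulH0.
Variable R : comNzRingType.

Fixpoint koszul_gen0 (rs : seq R) : gen (koszul rs) :=
  if rs is r :: rs' then (false, koszul_gen0 rs') else tt.

Lemma hdeg_koszul_eq0 rs (b : gen (koszul rs)) : hdeg b = 0%N -> b = koszul_gen0 rs.
Proof.
elim: rs b => [|r rs IH] //= => [[]//|[[] b] //=].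
by rewrite add0n => /IH ->.
Qed.

Lemma hdeg_koszul_gen0 rs : hdeg (koszul_gen0 rs) = 0%N.
Proof. by elim: rs => //= r rs ->. Qed.

(** With the next lemma this identifies the degree-0 boundaries with the ideal generated by [rs].
    That ideal is replaced by any [I] containing [rs], so that [I] can later be cut out by
    conditions on coefficients. *)
Lemma bd_koszul_gen0_in (I : submodule R^o) (rs : seq R) (b : gen (koszul rs)) :
  (forall r : R, r \in rs -> I r) -> I (bd b (koszul_gen0 rs)).
Proof.
elim: rs b => [|r rs IH] /= b Irs; first exact: submod0.
rewrite /tensor_bd /=; apply: submodD.
  rewrite /mult_bd; case: (b.1) => /=; last by rewrite mul0rn; apply: submod0.
  case: (_ == _); last exact: submod0.
  by rewrite mulr1n; apply: Irs; rewrite mem_head.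
case: (_ == _); last exact: submod0.
rewrite mulr1n; apply: (@submodZ _ R^o); apply: IH => s srs.
by apply: Irs; rewrite inE srs orbT.
Qed.

Lemma bd_koszul_gen0_ex rs r : r \in rs ->
  exists2 b : gen (koszul rs), hdeg b = 1%N & bd b (koszul_gen0 rs) = r.
Proof.
elim: rs => //= s rs IH; rewrite inE; case: eqP => [-> _|_ /= /IH [b b1 br]].
  exists (true, koszul_gen0 rs); rewrite /= ?hdeg_koszul_gen0 //.
  by rewrite /tensor_bd /= eqxx mulr0n addr0.
by exists (false, b) => //; rewrite /tensor_bd /= mul0rn add0r mul1r.
Qed.

(** It suffices to test [a] on the class of the degree-0 generator: [a] times that generator is then
    a boundary, so [a] is a combination of boundary coefficients lying in [I]. *)
Lemma koszul_H0_ann_in (rs : seq R) (I : submodule R^o) a : (forall r : R, r \in rs -> I r) ->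
  (forall h : homology (koszul rs) 0, a *: h = 0) -> I a.
Proof.
move=> Irs annh.
pose e : chain (koszul rs) := [ffun b => (b == koszul_gen0 rs)%:R].
have e0 : is_cycle 0 e.
  apply/andP; split.
    apply/forallP => b; rewrite ffunE;
    have [->|_] := eqVneq b (koszul_gen0 rs); last by rewrite eqxx.
    by rewrite hdeg_koszul_gen0 eqxx implybT.
  apply/eqP/ffunP => c; rewrite !ffunE big1 // => b _; rewrite ffunE.
  case: eqP => [->|_]; last by rewrite mul0r.
  have [->|/bd_deg] := eqVneq (bd (koszul_gen0 rs) c) 0; first by rewrite mulr0.
  by rewrite hdeg_koszul_gen0.
have : quotmod_pi (boundaries (koszul rs) 0) (a *: Cycle e0) = 0.
  by rewrite linearZ; apply: annh.
move=> /quotmod_pi_eq0 [y _ /ffunP /(_ (koszul_gen0 rs))].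
rewrite !ffunE eqxx /= => ya.
have -> : a = \sum_b y b * bd b (koszul_gen0 rs) by rewrite ya [RHS]mulr1.
by apply: (@submod_sum _ R^o) => b _; apply: (@submodZ _ R^o); apply: bd_koszul_gen0_in.
Qed.

Lemma koszul_H0_ann (rs : seq R) r (h : homology (koszul rs) 0) : r \in rs -> r *: h = 0.
Proof.
move=> /bd_koszul_gen0_ex [b b1 br]; have [z <-] := quotmod_surj h.
suff /quotmod_pi_eq0 : boundaries (koszul rs) 0 (r *: z) by rewrite linearZ.
have [/forallP z0 _] := andP (valP z).
(* In degree 0, [z] is a multiple of the single generator; the same multiple of [b] has boundary
   [r *: z]. *)
exists [ffun c => cycle_val z (koszul_gen0 rs) *+ (c == b)].
  apply/forallP => c; rewrite ffunE; have [->|_] := eqVneq c b; last by rewrite eqxx.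
  by rewrite b1 implybT.
apply/ffunP => c; rewrite !ffunE (bigD1 b) //= big1 => [|d /negPf db]; last first.
  by rewrite ffunE db mul0r.
rewrite ffunE eqxx mulr1n addr0.
have [hc|hc] := eqVneq (hdeg c) 0%N; first by rewrite (hdeg_koszul_eq0 hc) br [RHS]mulrC.
have -> : cycle_val z c = 0.
  by apply/eqP; move: (z0 c); rewrite (negPf hc) implybF negbK.
have [->|/bd_deg] := eqVneq (bd b c) 0; first by rewrite mulr0 scaler0.
by rewrite b1 => -[hc0]; rewrite -hc0 in hc.
Qed.

End KoszulH0.

(** * Ranks of families over the integers *)

(* By the Smith normal form, M has a zero row after a unimodular change of rows. *)
Lemma int_row_relation m n (M : 'M[int]_(m, n)) : (n < m)%N ->
  exists2 u : 'rV[int]_m, u != 0 & u *m M = 0.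
Proof.
case: m M => // m M ltnm; have [L uL [U uU [d _ ->]]] := int_Smith_normal_form M.
exists (delta_mx 0 ord_max *m invmx L).
  apply/eqP => /(congr1 (mulmx^~ L)); rewrite mulmxKV // mul0mx => /matrixP.
  by move=> /(_ 0 ord_max); rewrite !mxE !eqxx.
rewrite !mulmxA mulmxKV // -rowE.
set D := row _ _; have -> : D = 0; last by rewrite mul0mx.
apply/rowP => j; rewrite !mxE gtn_eqF //=.
by apply: leq_trans (ltn_ord j) _; rewrite -ltnS.
Qed.

(** If there were more [x] than [y], a relation between the rows of [c] would be a relation between
    the [x]. *)
Lemma Zfree_span_le (M : zmodType) m n (x : 'I_m -> M) (y : 'I_n -> M)
    (c : 'I_m -> 'I_n -> int) :
  (forall i, x i = \sum_j y j *~ c i j) -> Zfree x -> (m <= n)%N.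
Proof.
move=> xE freex; rewrite leqNgt; apply/negP => /(int_row_relation (\matrix_(i, j) c i j)).
case=> u /eqP u0 /rowP uM; apply: u0; apply/rowP => i; rewrite mxE.
apply: (freex (fun i => u 0 i)).
under eq_bigr do rewrite xE mulrz_suml.
rewrite exchange_big big1 //= => j _.
under eq_bigr do rewrite -mulrzA.
rewrite -mulrz_sumr; have := uM j; rewrite !mxE.
under eq_bigr do rewrite mxE mulrC.
by move=> ->; rewrite mulr0z.
Qed.

(** * Undirected cycles, potentials and cuts *)

Section Cycles.
Variable G : digraph.
Implicit Types (e x y : edge G) (u w v : vertex G) (S : {set edge G}).

Lemma joinsC e u w : joins e u w = joins e w u.
Proof. by rewrite /joins orbC. Qed.

Lemma joins_source_target e : joins e (source e) (target e).
Proof. by rewrite /joins !eqxx. Qed.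

Lemma mem_inc_edges e v : (e \in inc_edges v) = (source e == v) || (target e == v).
Proof. by rewrite !inE. Qed.

Lemma joins_inc e u w : joins e u w -> e \in inc_edges u.
Proof. by rewrite mem_inc_edges => /orP[]/andP[su tu]; rewrite ?su ?tu ?orbT. Qed.

Lemma inc_edges_joins e v : e \in inc_edges v -> exists u, joins e v u.
Proof.
rewrite mem_inc_edges => /orP[/eqP <-|/eqP <-]; first by
  exists (target e); apply: joins_source_target.
by exists (source e); rewrite joinsC joins_source_target.
Qed.

Local Notation follows :=
  (fun a b : vertex G * edge G => joins a.2 a.1 b.1).

(** The edge stored in the last pair is not traversed, whence [belast]. *)
Lemma path_potential (T : Type) (phi : vertex G -> T) a q :
  path follows a q ->
  {in unzip2 (belast a q), forall e, phi (source e) = phi (target e)} ->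
  phi a.1 = phi (last a q).1.
Proof.
elim: q a => //= b q IH a /andP[ab bq] phiE.
rewrite -(IH b bq) => [|e eq]; last by apply: phiE; rewrite inE eq orbT.
have := phiE a.2 (mem_head _ _).
by case/orP: ab => /andP[/eqP <- /eqP <-].
Qed.

(** Rotated so that [x] comes first, the rest of the cycle is a path between the two ends of [x],
    and [phi] is constant along it. *)
Lemma ucycle_potential (T : Type) (phi : vertex G -> T) v s x :
  ucycle_through v s -> x \in unzip2 s ->
  {in unzip2 s, forall e, e != x -> phi (source e) = phi (target e)} ->
  phi (source x) = phi (target x).
Proof.
move=> /andP[/and4P[_ _ us cs] _] /mapP[a + ->] phiE => /rot_to [i q rotE].
have {}cs : path.cycle follows (a :: q) by rewrite -rotE rot_cycle.
have {us} : uniq (unzip2 (a :: q)) by rewrite -rotE /unzip2 map_rot rot_uniq.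
have {}phiE : {in unzip2 q, forall e, e != a.2 -> phi (source e) = phi (target e)}.
  move=> e eq; apply: phiE.
  by rewrite -(mem_rot i) -map_rot rotE inE eq orbT.
(* A cycle of length one: [x] is a loop. *)
case: q => [|b q] /= in cs phiE {rotE} *.
  by rewrite andbT /joins orbb in cs; case/andP: cs => /eqP -> /eqP ->.
case/andP: cs => ab bq /andP[aq _].
have ba : phi b.1 = phi a.1.
  rewrite (path_potential (phi := phi) bq) ?last_rcons // belast_rcons => e eq.
  by apply: phiE => //; apply: contraNneq aq => <-.
by case/orP: ab => /andP[/eqP -> /eqP ->].
Qed.

Definition adjacent_off v u w :=
  [&& u != v, w != v & [exists e, joins e u w]].

Lemma adjacent_off_closed v : closed (adjacent_off v) (predC1 v).
Proof. by move=> u w /and3P[uv wv _]; rewrite !inE uv wv. Qed.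

Section Walk.
Variables (v : vertex G) (y y' : edge G).

Definition pick_joining u w : edge G := odflt y [pick e | joins e u w].

(** The final vertex of the path gets no pair here; it is paired with the returning edge when the
    walk is closed up through [v]. *)
Fixpoint walk u (p : seq (vertex G)) :=
  if p is w :: p' then (u, pick_joining u w) :: walk w p' else [::].

Lemma pick_joiningP u w : adjacent_off v u w -> joins (pick_joining u w) u w.
Proof.
case/and3P=> _ _ /existsP[e euw]; rewrite /pick_joining.
by case: pickP => //= /(_ e); rewrite euw.
Qed.

Lemma unzip1_walk u p x : unzip1 (rcons (walk u p) (last u p, x)) = u :: p.
Proof. by elim: p u => //= w p IH u; rewrite IH. Qed.

Lemma walk_ends u p e : path (adjacent_off v) u p -> e \in unzip2 (walk u p) ->
  (source e \in u :: p) && (target e \in u :: p).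
Proof.
elim: p u => //= w p IH u /andP[/pick_joiningP uw wp]; rewrite inE.
case/orP=> [/eqP->|/(IH _ wp) /andP[es et]]; last by rewrite inE es inE et !orbT.
by case/orP: uw => /andP[/eqP -> /eqP ->]; rewrite !inE !eqxx !orbT.
Qed.

Lemma uniq_walk u p : path (adjacent_off v) u p -> uniq (u :: p) ->
  uniq (unzip2 (walk u p)).
Proof.
elim: p u => //= w p IH u /andP[/pick_joiningP uw wp] /andP[uwp up].
rewrite IH // andbT; apply: contra uwp => /(walk_ends wp) /andP[es et].
by case/orP: uw => /andP[/eqP us /eqP ut]; [rewrite -us|rewrite -ut].
Qed.

(** The trailing pair [(v, y)] is the wrap-around term that [path.cycle] appends to a cycle starting
    at [(v, y)]. *)
Lemma path_walk a u p : path (adjacent_off v) u p -> follows a (u, y') ->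
  joins y' (last u p) v ->
  path follows a (rcons (rcons (walk u p) (last u p, y')) (v, y)).
Proof.
elim: p a u => [|w p IH] a u /=; first by move=> _ -> ->.
by move=> /andP[/pick_joiningP uw wp] -> ly /=; apply: IH.
Qed.

(** The cycle leaves [v] by [y], follows [p] inside G - v and returns by [y']; no edge of the walk
    along [p] touches [v]. *)
Lemma ucycle_of_path u p : u != v -> path (adjacent_off v) u p -> uniq (u :: p) ->
  joins y v u -> joins y' v (last u p) -> y != y' ->
  exists2 s, ucycle_through v s &
    {in unzip2 s, forall e, e \in inc_edges v -> e = y \/ e = y'}.
Proof.
move=> uv adjp up vyu vyl yy'.
have vNp : v \notin u :: p.
  elim: p u uv adjp {up vyu vyl} => [|w p IH] u uv /=; first by rewrite inE eq_sym.
  by move=> /andP[/and3P[_ wv _] wp]; rewrite inE eq_sym (negPf uv) IH.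
have inc_walk e : e \in unzip2 (walk u p) -> e \notin inc_edges v.
  move=> /(walk_ends adjp) /andP[es et]; rewrite mem_inc_edges.
  by apply/norP; split; apply: contraNneq vNp => <-.
exists ((v, y) :: rcons (walk u p) (last u p, y')); last first.
  move=> e; rewrite /unzip2 map_cons map_rcons inE mem_rcons inE => /or3P[/eqP->|/eqP->|].
  - by left.
  - by right.
  - by move/inc_walk => /negPf->.
rewrite /ucycle_through inE eqxx andbT; apply/and4P; split => //.
- by rewrite /= unzip1_walk vNp.
- have [yi yi'] := (joins_inc vyu, joins_inc vyl).
  rewrite /= {2}/unzip2 map_rcons rcons_uniq (uniq_walk adjp up) andbT.
  rewrite /unzip2 map_rcons mem_rcons inE (negPf yy') /=.
  by apply/andP; split; [apply: contraL yi|apply: contraL yi'] => /inc_walk.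
- by apply: path_walk; rewrite // joinsC.
Qed.

End Walk.

(* The separating set is the component of G - v at the far end of y. *)
Lemma cuts_ucycles_separate v S y : cuts_ucycles v S -> S \subset inc_edges v ->
  y \in inc_edges v -> y \notin S ->
  exists K : {set vertex G},
    [/\ (source y \in K) != (target y \in K),
        {in ~: inc_edges v, forall e, (source e \in K) = (target e \in K)} &
        {in inc_edges v, forall e, e \notin S -> e != y ->
          (source e \in K) = (target e \in K)}].
Proof.
move=> cutS Sv yv yS; have [u vyu] := inc_edges_joins yv.
have uv : u != v.
  (* If [u] is [v], then [y] is a loop, a cycle by itself, which [S] must hit. *)
  apply: contra yS => /eqP uv; rewrite uv /joins orbb in vyu.
  have: ucycle_through v [:: (v, y)].
    by rewrite /ucycle_through inE eqxx andbT /Defs.ucycle /= andbT /joins vyu.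
  by move/cutS; rewrite has_seq1.
have [K KE] : exists K : {set vertex G}, forall w, (w \in K) = connect (adjacent_off v) u w.
  by exists [set w | connect (adjacent_off v) u w] => w; rewrite inE.
have vK : v \notin K.
  rewrite KE; apply/negP => /(closed_connect (@adjacent_off_closed v)).
  by rewrite !inE uv eqxx.
have uK : u \in K by rewrite KE.
exists K; split.
- by case/orP: vyu => /andP[/eqP -> /eqP ->]; rewrite (negPf vK) uK.
- move=> e; rewrite inE mem_inc_edges negb_or => /andP[sv tv]; rewrite !KE.
  have adj : adjacent_off v (source e) (target e).
    by rewrite /adjacent_off sv tv; apply/existsP; exists e; apply: joins_source_target.
  have adj' : adjacent_off v (target e) (source e).
    by rewrite /adjacent_off sv tv; apply/existsP; exists e; rewrite joinsC joins_source_target.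
  by apply/idP/idP => /connect_trans; apply; apply: connect1.
- move=> e ev eS ey; have [w vew] := inc_edges_joins ev.
  suff wK : w \notin K.
    by case/orP: vew => /andP[/eqP -> /eqP ->]; rewrite (negPf vK) (negPf wK).
  (* If [e] also led into [K], a simple path in [K] would close up with [y] and [e] to a cycle; [S]
     meets it and omits [y], so it contains [e]. *)
  apply: contra eS; rewrite KE => /connectP[p0 /shortenP[p adjp up _] wE].
  rewrite wE in vew; rewrite eq_sym in ey.
  have [s sv sE] := ucycle_of_path uv adjp up vyu vew ey.
  have /hasP[x xs xS] := cutS s sv.
  have [xy|<-//] := sE x xs (subsetP Sv x xS).
  by rewrite /= xy (negPf yS) in xS.
Qed.

(** If every cycle through [v] met [S] outside [x], deleting [x] would leave a smaller cut. That [x]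
    lies on its cycle [s] follows because [S] meets [s]. *)
Lemma beta_undirectedP v : exists S,
  [/\ S \subset inc_edges v, cuts_ucycles v S, beta_undirected v = #|S| &
     {in S, forall x, exists2 s, ucycle_through v s & {in unzip2 s, forall e, e \in S -> e = x}}].
Proof.
rewrite /beta_undirected; case: arg_minnP.
  (* The default [inc_edges v] is admissible: rotate the cycle to start at [v]; its first edge is
     incident at [v]. *)
  rewrite subxx; apply/asboolP => s /andP[/and4P[_ _ _ cs]] /mapP[a + ->].
  case/rot_to=> i q rotE; apply/hasP; exists a.2.
    by apply: map_f; rewrite -(mem_rot i) rotE mem_head.
  move: cs; rewrite -(rot_cycle i) rotE /=.
  by case: q {rotE} => [|b q] /= /andP[/joins_inc].
move=> S /andP[Sv /asboolP cutS] minS; exists S; split => // x xS.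
apply: contrapT => nos.
suff /minS : (S :\ x \subset inc_edges v) && `[< cuts_ucycles v (S :\ x) >].
  by rewrite (cardsD1 x S) xS ltnn.
rewrite (subset_trans (subsetDl _ _) Sv); apply/asboolP => s sv.
apply/hasP; apply: contrapT => nohit; apply: nos; exists s => // e es eS.
by apply: contrapT => /eqP ex; apply: nohit; exists e; rewrite //= !inE ex.
Qed.

(** Picking from each cycle of a packing one of its edges in [S] is injective, by disjointness. *)
Lemma alpha_le_cut v S : cuts_ucycles v S -> (alpha_undirected v <= #|S|)%N.
Proof.
move=> cutS; apply/bigmax_leqP => P /andP[trP /forallP PC].
have hit C : C \in P -> C :&: S != set0.
  move=> CP; have := PC C; rewrite CP => /asboolP[s /cutS /hasP[x xs xS] ->].
  by apply/set0Pn; exists x; rewrite !inE xs.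
(* A nonempty packing supplies the default edge [x0] for the choice function [f]. *)
have [->|[C0 C0P]] := set_0Vmem P; first by rewrite cards0.
have [x0 _] := set0Pn _ (hit _ C0P).
pose f C := odflt x0 [pick x in C :&: S].
have fP C : C \in P -> f C \in C :&: S.
  move=> /hit/set0Pn[x xC]; rewrite /f; case: pickP => //= /(_ x).
  by rewrite xC.
rewrite -(@card_in_imset _ _ f P) => [|C D CP DP fCD].
  by apply/subset_leq_card/subsetP => _ /imsetP[C CP ->]; case/setIP: (fP C CP).
apply/eqP/negP => /negP CD; have /trivIsetP/(_ C D CP DP CD) := trP.
move/pred0P/(_ (f C)) => /=; case/setIP: (fP C CP) => -> _.
by rewrite fCD; case/setIP: (fP D DP) => ->.
Qed.

End Cycles.

(** * Constant and linear coefficients modulo [Delta] *)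

Section LinearPart.
Variable G : digraph.
Implicit Types (x y : edge G) (w v : vertex G) (A S : {set edge G}).

Definition const_coef : {rmorphism polyE G -> int} := meval (fun=> 0).

(** The coefficient of the monomial [x], taken as a partial derivative at the origin so that the
    Leibniz rule gives products. *)
Definition lin_coef x (p : polyE G) : int := (p^`M(enum_rank x)).@[fun=> 0].

Lemma lin_coef_is_zmod_morphism x : zmod_morphism (lin_coef x).
Proof. by move=> p q; rewrite /lin_coef raddfB /= mevalB. Qed.

HB.instance Definition _ x :=
  GRing.isZmodMorphism.Build (polyE G) int (lin_coef x) (lin_coef_is_zmod_morphism x).

Lemma lin_coefM x (p q : polyE G) :
  lin_coef x (p * q) = lin_coef x p * const_coef q + const_coef p * lin_coef x q.
Proof. by rewrite /lin_coef mderivM mevalD !mevalM. Qed.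

Lemma const_coef_edge_var y : const_coef (edge_var y) = 0.
Proof. exact: mevalXU. Qed.

Lemma lin_coef_edge_var x y : lin_coef x (edge_var y) = (x == y)%:R.
Proof.
rewrite /lin_coef mderivX mevalZ mnm1E (inj_eq enum_rank_inj) eq_sym.
case: eqP => [->|_]; last by rewrite mul0r.
by rewrite mul1r mevalX big1 // => i _; rewrite mnmBE subnn.
Qed.

Lemma const_coef_prod S : S != set0 -> const_coef (\prod_(x in S) edge_var x) = 0.
Proof.
by case/set0Pn => a aS; rewrite (big_setD1 a aS) rmorphM /= const_coef_edge_var mul0r.
Qed.

Lemma const_coef_esym A l : const_coef (Defs.esym A l.+1) = 0.
Proof.
rewrite rmorph_sum big1 // => S /andP[_ Sl].
by rewrite const_coef_prod // -card_gt0 (eqP Sl).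
Qed.

Lemma esym1 A : Defs.esym A 1 = \sum_(x in A) edge_var x.
Proof.
rewrite /Defs.esym (eq_bigl (mem [set [set x] | x in A])) => [|S]; last first.
  apply/andP/imsetP => [[SA /cards1P[x Sx]]|[x xA ->]]; last by rewrite sub1set xA cards1.
  by exists x => //; move: SA; rewrite Sx sub1set.
rewrite big_imset /=; last by move=> x y _ _; apply: set1_inj.
by apply: eq_bigr => x _; rewrite big_set1.
Qed.

(** Beyond [e_1] every term is a product of at least two variables, whose derivative vanishes at the
    origin. *)
Lemma lin_coef_esym x A l : lin_coef x (Defs.esym A l.+1) = ((l == 0%N) && (x \in A))%:R.
Proof.
case: l => [|l] /=.
  rewrite esym1 raddf_sum /=; under eq_bigr do rewrite lin_coef_edge_var.
  have [xA|xA] := boolP (x \in A).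
    rewrite (bigD1 x) //= eqxx big1 ?addr0 // => y /andP[_ yx].
    by rewrite eq_sym (negPf yx).
  by rewrite big1 // => y yA; case: eqP xA => // ->; rewrite yA.
rewrite raddf_sum big1 // => S /andP[_ /eqP Sl] /=.
have [a aS] : exists a, a \in S by apply/set0Pn; rewrite -card_gt0 Sl.
rewrite (big_setD1 a aS) lin_coefM const_coef_edge_var mul0r addr0.
rewrite const_coef_prod ?mulr0 // -card_gt0.
by rewrite (cardsD1 a) aS add1n in Sl; case: Sl => ->.
Qed.

Lemma const_coef_delta w l : const_coef (delta w l.+1) = 0.
Proof. by rewrite rmorphB /= !const_coef_esym subrr. Qed.

Lemma lin_coef_delta x w l :
  lin_coef x (delta w l.+1) =
    ((l == 0%N) && (source x == w))%:R - ((l == 0%N) && (target x == w))%:R.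
Proof. by rewrite raddfB /= !lin_coef_esym !inE. Qed.

Lemma delta1_in_Delta w : delta w 1 \in Delta G.
Proof.
apply/allpairsPdep; exists w, 1%N; rewrite mem_enum mem_iota /=; split => //.
rewrite /kmax add1n ltnS leq_max !card_gt0.
(* Degree 0 being excluded, [kmax w] is at least 1. *)
have [x /orP[xw|xw]] := no_isolated w; apply/orP; [left|right];
  by apply/set0Pn; exists x; rewrite inE.
Qed.

(** The linear part is a coboundary. With m the ideal of all variables, this describes the ideal
    (Delta) + m^2 by coefficients. *)
Definition linearly_exact (p : polyE G) : Prop :=
  const_coef p = 0 /\
  exists phi : vertex G -> int, forall x, lin_coef x p = phi (source x) - phi (target x).

Lemma linearly_exact0 : linearly_exact 0.
Proof. by split; [exact: raddf0|exists (fun=> 0) => x; rewrite raddf0 subrr]. Qed.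

Lemma linearly_exactP (a p q : (polyE G)^o) :
  linearly_exact p -> linearly_exact q -> linearly_exact (a *: p + q).
Proof.
move=> [p0 [phi pE]] [q0 [psi qE]]; split.
  by rewrite rmorphD rmorphM /= p0 q0 mulr0 addr0.
(* As [p] has no constant term, only the constant term of [a] reaches the linear part of [a * p]. *)
exists (fun w => const_coef a * phi w + psi w) => x.
by rewrite raddfD /= lin_coefM p0 mulr0 add0r pE qE mulrBr addrACA opprD.
Qed.

Definition linearly_exact_submodule : submodule (polyE G)^o :=
  @Submodule (polyE G) (polyE G)^o linearly_exact linearly_exact0 linearly_exactP.

Lemma linearly_exact_Delta p : p \in Delta G -> linearly_exact p.
Proof.
case/allpairsPdep => w [[|l]] []; rewrite mem_iota // => _ _ ->.
split; first exact: const_coef_delta.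
(* The potential of [delta w 1] is the indicator of [w]; the higher ones have no linear part. *)
exists (fun u => ((l == 0%N) && (u == w))%:R) => x; exact: lin_coef_delta.
Qed.

Lemma scrH0_ann_linearly_exact (p : polyE G) :
  (forall h : scrH0 G, p *: h = 0) -> linearly_exact p.
Proof.
exact: (koszul_H0_ann_in (I := linearly_exact_submodule)) linearly_exact_Delta.
Qed.

Section AtVertex.
Variable v : vertex G.

Local Notation annV := (annihilator (embed (inc_edges v)) (scrH0 G)).

Definition edge_form (c : edge G -> int) : polyV v :=
  \sum_i c (enum_val i) *: ('X_i : {mpoly int[#|inc_edges v|]}).

Lemma embed_edge_form c :
  embed (inc_edges v) (edge_form c) = \sum_(x in inc_edges v) edge_var x *~ c x.
Proof.
rewrite rmorph_sum [RHS]big_enum_val /=; apply: eq_bigr => i _.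
by rewrite [LHS]mmapZ mmapX mmap1U mulrzl.
Qed.

Lemma lin_coef_edge_form x c :
  lin_coef x (embed (inc_edges v) (edge_form c)) = if x \in inc_edges v then c x else 0.
Proof.
rewrite embed_edge_form raddf_sum /=.
under eq_bigr do rewrite raddfMz /= lin_coef_edge_var.
case: ifPn => xv; last first.
  by rewrite big1 // => y yv; case: eqP xv => [->|_ _]; rewrite ?yv // mul0rz.
rewrite (bigD1 x) //= eqxx intz big1 ?addr0 // => y /andP[_ yx].
by rewrite eq_sym (negPf yx) mul0rz.
Qed.

(** Forwards, compare linear coefficients over all edges. Backwards, the form equals the combination
    of the [delta w 1] with weights [phi w], and these kill H_0. *)
Lemma edge_form_ann c : annV (edge_form c) <->
  exists phi : vertex G -> int,
    {in inc_edges v, forall x, c x = phi (source x) - phi (target x)} /\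
    {in ~: inc_edges v, forall x, phi (source x) = phi (target x)}.
Proof.
split=> [/scrH0_ann_linearly_exact [_ [phi phiE]]|[phi [cE phiE]] h].
  exists phi; split=> x xv; move: (phiE x); rewrite lin_coef_edge_form.
    by rewrite xv.
  by rewrite inE in xv; rewrite (negPf xv) => /esym/eqP; rewrite subr_eq0 => /eqP.
have -> : embed (inc_edges v) (edge_form c) = \sum_w delta w 1 *~ phi w.
  rewrite embed_edge_form /delta.
  under [RHS]eq_bigr do rewrite !esym1 mulrzBl !mulrz_suml.
  (* Sum over edges first: an edge is counted once at its source and once, negatively, at its
     target. *)
  rewrite sumrB [X in X - _](exchange_big_dep xpredT) // [X in _ - X](exchange_big_dep xpredT) //=.
  rewrite -sumrB big_mkcond /=; apply: eq_bigr => x _.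
  rewrite (big_pred1 (source x)) => [|w]; last by rewrite inE eq_sym.
  rewrite (big_pred1 (target x)) => [|w]; last by rewrite inE eq_sym.
  rewrite -mulrzBr; case: ifPn => xv; first by rewrite cE.
  by rewrite phiE ?in_setC // subrr mulr0z.
rewrite scaler_suml big1 // => w _; rewrite -mulrzl -scalerA.
by rewrite (koszul_H0_ann h (delta1_in_Delta w)) scaler0.
Qed.

Lemma edge_form_homog c : (edge_form c : {mpoly int[#|inc_edges v|]}) \is 1.-homog.
Proof. by apply: rpred_sum => i _; apply: rpredZ; rewrite dhomogX /=; apply/eqP; apply: mdeg1. Qed.

Lemma homog1_edge_form (p : {mpoly int[#|inc_edges v|]}) :
  p \is 1.-homog -> exists c, p = edge_form c.
Proof.
(* The inner sum has one term for an edge at [v] and none otherwise, so it extends the coefficients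
   by 0. *)
move=> /dhomogP p1; exists (fun x => \sum_(i | enum_val i == x) p@_U_(i)).
pose q : {mpoly int[#|inc_edges v|]} := \sum_i p@_(U_(i)) *: 'X_i.
transitivity q; last first.
  by apply: eq_bigr => i _; rewrite (big_pred1 i) // => j; rewrite /= (inj_eq enum_val_inj).
apply/mpolyP => m; rewrite raddf_sum /=.
under eq_bigr do rewrite mcoeffZ mcoeffX.
have [/p1/eqP|mp] := boolP (m \in msupp p).
  case/mdeg1P => i /eqP ->; rewrite (bigD1 i) //= eqxx mulr1 big1 ?addr0 // => j ji.
  by rewrite eq_mnm1 (negPf ji) mulr0.
rewrite (memN_msupp_eq0 mp) big1 // => i _.
by case: eqP mp => [<- mp|_ _]; rewrite ?mulr0 // (memN_msupp_eq0 mp) mul0r.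
Qed.

Lemma edge_formB c c' : edge_form (fun x => c x - c' x) = edge_form c - edge_form c'.
Proof. by rewrite /edge_form -sumrB; apply: eq_bigr => i _; rewrite scalerBl. Qed.

Lemma edge_form_sum (I : finType) (c : I -> edge G -> int) (a : I -> int) :
  edge_form (fun x => \sum_i c i x *~ a i) = \sum_i edge_form (c i) *~ a i.
Proof.
rewrite /edge_form; under [RHS]eq_bigr do rewrite mulrz_suml.
rewrite exchange_big /=; apply: eq_bigr => i _; rewrite scaler_suml.
by apply: eq_bigr => j _; rewrite -scalerMzl.
Qed.

End AtVertex.
End LinearPart.

(** Each edge [y] at [v] outside [S] has a potential whose coboundary is 1 on [y], 0 on the other
    such edges and 0 away from [v]; these are superposed with weights [c y]. *)
Lemma cut_potential (G : digraph) (v : vertex G) S (c : edge G -> int) :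
  cuts_ucycles v S -> S \subset inc_edges v ->
  exists phi : vertex G -> int,
    {in inc_edges v :\: S, forall x, c x = phi (source x) - phi (target x)} /\
    {in ~: inc_edges v, forall x, phi (source x) = phi (target x)}.
Proof.
move=> cutS Sv; pose B := inc_edges v :\: S.
have /choice[psi psiP] : forall y, exists psi : vertex G -> int, y \in B ->
    {in B, forall x, psi (source x) - psi (target x) = (x == y)%:R} /\
    {in ~: inc_edges v, forall x, psi (source x) = psi (target x)}.
  move=> y; have [yB|] := boolP (y \in B); last by exists (fun=> 0).
  have /setDP[yv yS] := yB.
  have [K [Ky Kout Kin]] := cuts_ucycles_separate cutS Sv yv yS.
  (* This sign, 1 or -1, makes the coboundary of the indicator of [K] equal to +1 on [y]. *)
  pose sgn : int := (source y \in K)%:R - (target y \in K)%:R.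
  exists (fun w => sgn * (w \in K)%:R) => _; split=> [x /setDP[xv xS]|x /Kout -> //].
  have [->|xy] := eqVneq x y.
    by rewrite -mulrBr /sgn; case: (source y \in K) (target y \in K) Ky => [] [].
  by rewrite Kin // subrr.
exists (fun w => \sum_(y in B) psi y w * c y); split=> x xB; last first.
  by apply: eq_bigr => y yB; rewrite (psiP y yB).2.
rewrite -sumrB (bigD1 x) //= -mulrBl (psiP x xB).1 // eqxx mul1r big1 ?addr0 //.
move=> y /andP[yB yx]; rewrite -mulrBl (psiP y yB).1 //.
by rewrite eq_sym (negPf yx) mul0r.
Qed.

(** * The ideal generated by the variables *)

Section IrrelevantIdeal.
Variables (R : comNzRingType) (n : nat).

Local Notation irrelevant :=
  (ideal_gen (fun i : 'I_n => 'X_i : {mpoly R[n]})).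

Lemma irrelevant_gen i : irrelevant 'X_i.
Proof.
exists (fun j => (j == i)%:R); rewrite (bigD1 i) //= eqxx mul1r big1 ?addr0 //.
by move=> j /negPf ->; rewrite mul0r.
Qed.

Lemma irrelevant_add_const (p : {mpoly R[n]}) : exists k, irrelevant (p - k%:MP).
Proof.
elim/mpolyind: p => [|c m p _ _ [k Ik]].
  by exists 0; rewrite mpolyC0 subr0; apply: submod0.
have [->|m0] := eqVneq m 0%MM.
  by exists (c + k); rewrite mpolyX0 alg_mpolyC mpolyCD opprD addrACA subrr add0r.
exists k; rewrite -addrA; apply: submodD => //.
have [i mi] : exists i, m i != 0%N.
  apply/existsP; apply: contraNT m0; rewrite negb_exists => /forallP m0.
  by apply/eqP/mnmP => i; rewrite mnm0E; apply/eqP/negPn; apply: m0.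
(* A nonconstant monomial is divisible by some variable. *)
have -> : m = (m - U_(i) + U_(i))%MM by rewrite submK // lep1mP.
rewrite mpolyXD -mul_mpolyC mulrA; apply: (@submodZ _ {mpoly R[n]}^o); apply: irrelevant_gen.
Qed.

End IrrelevantIdeal.

Lemma graded_iso_quot n (I J : submodule {mpoly int[n]}^o) : I = J ->
  graded_iso (@qcomponent n I) (@qcomponent n J).
Proof. by move=> ->; exists idfun; split => //; exists idfun. Qed.

(** * The module A(v) and its component of degree 1 *)

Section AtVertex.
Variables (G : digraph) (v : vertex G).

Local Notation annV := (annihilator (embed (inc_edges v)) (scrH0 G)).
Local Notation irrV := (ideal_gen (fun i : 'I_#|inc_edges v| => 'X_i : polyV v)).

(** An annihilating polynomial has constant term 0, since [linearly_exact] demands it of its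
    image. *)
Lemma ann_irrelevant p : annV p -> irrV p.
Proof.
have [k [c pE]] := irrelevant_add_const p.
move=> /scrH0_ann_linearly_exact[+ _].
have {}pE : p = \sum_i c i * 'X_i + k%:MP by rewrite -pE subrK.
have embedX i : embed (inc_edges v) 'X_i = edge_var (enum_val i).
  by rewrite [LHS]mmapX mmap1U.
have embedC : embed (inc_edges v) k%:MP = k%:~R by apply: mmapC.
have embedS : const_coef G (embed (inc_edges v) (\sum_i c i * 'X_i)) = 0.
  rewrite (rmorph_sum (embed (inc_edges v))) (rmorph_sum (const_coef G)) big1 // => i _.
  by rewrite !rmorphM embedX [X in _ * X]const_coef_edge_var mulr0.
rewrite {1}pE !rmorphD embedS embedC rmorph_int intz add0r => k0.
by exists c; rewrite pE k0 mpolyC0 addr0.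
Qed.

Definition edge_class x : Aloc v :=
  quotmod_pi annV (edge_form v (fun y => (y == x)%:R)).

Lemma edge_class_homog x : Acomp 1 (edge_class x).
Proof. by exists (edge_form v (fun y => (y == x)%:R)) => //; apply: edge_form_homog. Qed.

Lemma sum_edge_class (I : finType) (f : I -> edge G) (a : I -> int) :
  \sum_i edge_class (f i) *~ a i =
  quotmod_pi annV (edge_form v (fun y => \sum_i (y == f i)%:R *~ a i)).
Proof.
rewrite edge_form_sum raddf_sum /=; apply: eq_bigr => i _.
by rewrite raddfMz.
Qed.

Lemma Acomp1_span S (a : Aloc v) : cuts_ucycles v S -> S \subset inc_edges v ->
  Acomp 1 a -> exists c : 'I_#|S| -> int, a = \sum_i edge_class (enum_val i) *~ c i.
Proof.
move=> cutS Sv [_ /homog1_edge_form[c ->] ->].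
have [phi [phiS phiE]] := cut_potential c cutS Sv.
(* On edges at [v] this vanishes outside [S], and it differs from [c] by a coboundary, which is zero
   in A(v). *)
pose d x := c x - (phi (source x) - phi (target x)).
exists (fun i => d (enum_val i)); rewrite sum_edge_class; apply/quotmod_piE.
rewrite -edge_formB; apply/edge_form_ann; exists phi; split=> // x xv.
rewrite -(big_enum_val (fun y => (x == y)%:R *~ d y)).
have [xS|xS] := boolP (x \in S).
  rewrite (bigD1 x) //= eqxx big1 => [|y /andP[_ yx]].
    by rewrite intz addr0 /d subKr.
  by rewrite eq_sym (negPf yx) mul0rz.
rewrite big1 => [|y yS]; first by rewrite subr0 phiS // inE xS.
by case: eqP xS => [->|_ _]; rewrite ?yS // mul0rz.
Qed.

Lemma edge_class_free S : cuts_ucycles v S -> S \subset inc_edges v ->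
  {in S, forall x, exists2 s, ucycle_through v s & {in unzip2 s, forall e, e \in S -> e = x}} ->
  Zfree (fun i : 'I_#|S| => edge_class (enum_val i)).
Proof.
move=> cutS Sv minS c; rewrite sum_edge_class.
move=> /quotmod_pi_eq0/edge_form_ann[phi [phiS phiE]] i.
pose x := enum_val i; have xS : x \in S := enum_valP i.
have [s sv sx] := minS x xS.
have /hasP[x' x's x'S] := cutS s sv.
(* [S] meets [s], and can do so only in [x]. *)
have xs : x \in unzip2 s by rewrite -(sx x' x's x'S).
have : phi (source x) = phi (target x).
  apply: ucycle_potential sv xs _ => e es ex.
  have [ev|ev] := boolP (e \in inc_edges v); last by rewrite phiE ?in_setC.
  apply/eqP; rewrite -subr_eq0 -phiS //; apply/eqP.
  rewrite big1 // => j _; case: eqP => [ej|_]; last by rewrite mul0rz.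
  by rewrite (sx e es) ?eqxx ?ej ?enum_valP // in ex.
move/eqP; rewrite -subr_eq0 -phiS ?(subsetP Sv) // (bigD1 i) //= eqxx intz.
rewrite big1 ?addr0 => [/eqP //|j ji].
by rewrite (inj_eq enum_val_inj) eq_sym (negPf ji) mul0rz.
Qed.

(** Without cycles the empty set is a cut, so the empty family spans. *)
Lemma acyclic_Acomp1_eq0 (a : Aloc v) : ~ (exists s, ucycle_through v s) ->
  Acomp 1 a -> a = 0.
Proof.
move=> nos /(@Acomp1_span set0)[||c ->]; rewrite ?sub0set //.
  by move=> s sv; case: nos; exists s.
by rewrite big1 // => i _; have := enum_valP i; rewrite inE.
Qed.

Lemma cyclic_Acomp1_neq0 : (exists s, ucycle_through v s) ->
  exists a : Aloc v, Acomp 1 a /\ a <> 0.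
Proof.
case=> s sv; have [S [Sv cutS _ minS]] := beta_undirectedP v.
have /hasP[x _ xS] := cutS s sv.
exists (edge_class x); split; first exact: edge_class_homog.
(* Were the class of [x] zero, the indicator of [x] would be a nontrivial relation in a free
   family. *)
move=> x0; have /(_ (fun i => (enum_val i == x)%:R)) := edge_class_free cutS Sv minS.
rewrite -(big_enum_val (fun y => edge_class y *~ (y == x)%:R)) big1 => [|y _].
  by move=> /(_ erefl (enum_rank_in xS x)); rewrite enum_rankK_in // eqxx.
by case: eqP => [->|_]; rewrite ?x0 ?mul0rz ?mulr0z.
Qed.

(** Every variable has its class in degree 1, which is zero, so it lies in the annihilator. *)
Lemma acyclic_ann : ~ (exists s, ucycle_through v s) -> annV = irrV.
Proof.
move=> nos; apply: submod_eq => p; split; first exact: ann_irrelevant.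
case=> c ->; apply: (@submod_sum _ (polyV v)^o) => i _.
apply: (@submodZ _ (polyV v)^o); apply/quotmod_pi_eq0.
apply: acyclic_Acomp1_eq0 nos _; exists 'X_i => //.
by rewrite dhomogX /=; apply/eqP; apply: mdeg1.
Qed.

Lemma Zcomp1_eq0 (a : Ztriv v) : Zcomp 1 a -> a = 0.
Proof.
case=> _ /homog1_edge_form[c ->] ->; apply/quotmod_pi_eq0.
apply: submod_sum => i _; rewrite -mul_mpolyC.
by apply: (@submodZ _ (polyV v)^o); apply: irrelevant_gen.
Qed.

Lemma has_rank_Acomp1 : has_rank (@Acomp G v 1) (beta_undirected v).
Proof.
have [S [Sv cutS -> minS]] := beta_undirectedP v; split.
  exists (fun i => edge_class (enum_val i)); split; last exact: edge_class_free.
  by move=> i; apply: edge_class_homog.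
move=> n x x1 freex.
have /choice[c cE] := fun i => Acomp1_span cutS Sv (x1 i).
exact: Zfree_span_le cE freex.
Qed.

End AtVertex.

Theorem theorem1p18 (G : digraph) (v : vertex G) :
  ((~ exists s, ucycle_through v s) <->
     graded_iso (@Acomp G v) (@Zcomp G v)) /\
  ((exists s, ucycle_through v s) <->
     exists a : Aloc v, Acomp 1 a /\ a <> 0%R) /\
  (exists r : nat,
     has_rank (@Acomp G v 1) r /\ (alpha_undirected v <= r)%N /\ (r <= beta_undirected v)%N).
Proof.
split; [split=> [nos|[f [bij_f fE]] s]|split; [split=> [|[a [a1 a0]]]|]].
- exact: graded_iso_quot (acyclic_ann nos).
- have [a [a1 []]] := cyclic_Acomp1_neq0 s.
  (* A graded isomorphism sends [a] into the degree-1 part of the trivial module, which is zero. *)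
  by apply: (bij_inj bij_f); rewrite raddf0; apply: Zcomp1_eq0; apply/fE.
- exact: cyclic_Acomp1_neq0.
- by apply: contrapT => /acyclic_Acomp1_eq0 /(_ a1).
(* The rank is exactly beta, so only alpha <= beta remains. *)
- exists (beta_undirected v); split; first exact: has_rank_Acomp1.
  split=> //; have [S [_ cutS -> _]] := beta_undirectedP v.
  exact: alpha_le_cut.
Qed.
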